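(* Let $I$ be a strongly stable ideal of $S=\mathbb{K}[x,y,z]$ such that $S/I$ has the strong Lefschetz property. Then $I$ is an almost revlex ideal and it is uniquely determined by the Hilbert function (that is, if $I'$ is a strongly stable ideal of $S$ such that $S/I'$ has the strong Lefschetz property and $S/I'$ has the same Hilbert function as $S/I$, then $I'=I$).
   Context: $\mathbb{K}$ is a field of characteristic $0$; $S=\mathbb{K}[x,y,z]$ has the standard grading; the variables are ordered $x=x_1$, $y=x_2$, $z=x_3$; ''power-product'' means monomial with coefficient $1$. A monomial ideal $I$ is strongly stable if for every power-product $t\in I$ and all $i<j$ with $x_j\mid t$, one has $x_i\cdot t/x_j\in I$. A monomial ideal $I$ is an almost revlex ideal if for every power-product $t$ in the minimal generating set of $I$, every power-product $t'$ of $S$ with $\deg(t')=\deg(t)$ and $t'>_{\mathrm{DegRevLex}}t$ belongs to $I$, where DegRevLex is the degree reverse lexicographic ordering with $x>y>z$. A graded ring $R=\bigoplus_{i\ge0}R_i$ over $\mathbb{K}$ with $\dim_{\mathbb{K}}R_i<\infty$ has the strong Lefschetz property (SLP) if there exists $\ell\in R_1$ such that for all $i\ge0$ and $s\ge1$ the map $\times\ell^s\colon R_i\to R_{i+s}$ has full rank (is injective or surjective). The Hilbert function of $R$ is $i\mapsto\dim_{\mathbb{K}}R_i$. Artinianity of $S/I$ is not assumed. *)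

(* Defs.v *)
From HB Require Import structures.
From mathcomp Require Import all_boot all_order all_algebra.
From mathcomp Require Export mpoly.

Set Implicit Arguments.
Unset Strict Implicit.
Unset Printing Implicit Defensive.

Import GRing.Theory.
Local Open Scope ring_scope.
Local Open Scope quotient_scope.

(* The library's [idealr] only covers proper ideals; here the unit ideal has to
   be allowed too, so that the quotient ring may be zero. *)
Definition ideal_closed (R : comNzRingType) (I : {pred R}) : Prop :=
  [/\ 0 \in I,
      {in I &, forall u v, u + v \in I}
    & forall a, {in I, forall u, a * u \in I}].

Record ideal (R : comNzRingType) : Type := Ideal {
  ideal_pred :> {pred R};
  idealP : ideal_closed ideal_pred
}.

Section IdealTheory.
Variables (R : comNzRingType) (I : ideal R).

Lemma idealM a u : u \in I -> a * u \in I.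
Proof. by case: (idealP I) => _ _; apply. Qed.

Lemma ideal_zmod_closed : zmod_closed (ideal_pred I).
Proof.
case: (idealP I) => I0 ID IM; split=> // u v uI vI.
by rewrite -mulN1r; apply: ID => //; apply: IM.
Qed.

HB.instance Definition _ :=
  GRing.isZmodClosed.Build R (ideal_pred I) ideal_zmod_closed.
End IdealTheory.

(* The quotient ring R / I.  This is a separate alias because the ring
   structure on [Quotient.quot] is reserved for proper ideals. *)
Definition quot_ring (R : comNzRingType) (I : ideal R) : Type :=
  Quotient.quot (ideal_pred I : zmodClosed R).

Section QuotRing.
Variables (R : comNzRingType) (I : ideal R).
Local Notation Q := (quot_ring I).

HB.instance Definition _ := EqQuotient.on Q.
HB.instance Definition _ := GRing.Zmodule.on Q.

Definition quot_pi (p : R) : Q := \pi_Q p.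

Lemma quot_piP (p q : R) : quot_pi p = quot_pi q <-> p - q \in I.
Proof.
rewrite (Quotient.idealrBE (ideal_pred I : zmodClosed R)).
by split=> [eq_pq|/eqP eq_pq]; first apply/eqP; exact: eq_pq.
Qed.

Lemma quot_reprK (x : Q) : quot_pi (repr x) = x.
Proof. exact: reprK. Qed.

Lemma quot_piD (p q : R) : quot_pi (p + q) = quot_pi p + quot_pi q.
Proof. exact: (Quotient.pi_add (ideal_pred I : zmodClosed R)). Qed.

Definition quot_one : Q := quot_pi 1.
Definition quot_mul (x y : Q) : Q := quot_pi (repr x * repr y).

Lemma quot_mulE (p q : R) : quot_mul (quot_pi p) (quot_pi q) = quot_pi (p * q).
Proof.
apply/quot_piP; set p' := repr _; set q' := repr _.
have pI : p' - p \in I by apply/quot_piP; rewrite quot_reprK.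
have qI : q' - q \in I by apply/quot_piP; rewrite quot_reprK.
have -> : p' * q' - p * q = q' * (p' - p) + p * (q' - q).
  by rewrite !mulrBr addrA [q' * p']mulrC [q' * p]mulrC subrK.
by apply: rpredD; apply: idealM.
Qed.

Lemma quot_mulA : associative quot_mul.
Proof.
move=> x y z; rewrite -[x]quot_reprK -[y]quot_reprK -[z]quot_reprK.
move: (repr x) (repr y) (repr z) => p q r.
by rewrite (quot_mulE q r) (quot_mulE p q) (quot_mulE p) (quot_mulE _ r) mulrA.
Qed.

Lemma quot_mulC : commutative quot_mul.
Proof. by move=> x y; rewrite /quot_mul mulrC. Qed.

Lemma quot_mul1 : left_id quot_one quot_mul.
Proof. by move=> x; rewrite -[x]quot_reprK (quot_mulE 1) mul1r. Qed.

Lemma quot_mulDl : left_distributive quot_mul +%R.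
Proof.
move=> x y z; rewrite -[x]quot_reprK -[y]quot_reprK -[z]quot_reprK.
move: (repr x) (repr y) (repr z) => p q r.
rewrite -(quot_piD p q) (quot_mulE p r) (quot_mulE q r) (quot_mulE _ r).
by rewrite mulrDl quot_piD.
Qed.

HB.instance Definition _ := GRing.Zmodule_isComPzRing.Build Q
  quot_mulA quot_mulC quot_mul1 quot_mulDl.

Lemma quot_piM (p q : R) : quot_pi (p * q) = quot_pi p * quot_pi q.
Proof. by rewrite -quot_mulE. Qed.
End QuotRing.

Section QuotModule.
Variables (n : nat) (K : fieldType) (I : ideal {mpoly K[n]}).
Local Notation Q := (quot_ring I).

Definition quot_scale (a : K) (x : Q) : Q := quot_pi I (a *: repr x).

Lemma quot_scaleE a (p : {mpoly K[n]}) :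
  quot_scale a (quot_pi I p) = quot_pi I (a *: p).
Proof.
apply/quot_piP; rewrite -scalerBr -mul_mpolyC; apply: idealM.
by apply/quot_piP; rewrite quot_reprK.
Qed.

Lemma quot_scaleA a b x : quot_scale a (quot_scale b x) = quot_scale (a * b) x.
Proof.
rewrite -[x]quot_reprK; move: (repr x) => p.
by rewrite (quot_scaleE b p) (quot_scaleE a) (quot_scaleE _ p) scalerA.
Qed.

Lemma quot_scale1 : left_id 1 quot_scale.
Proof. by move=> x; rewrite -[x]quot_reprK (quot_scaleE 1) scale1r. Qed.

Lemma quot_scaleDr : right_distributive quot_scale +%R.
Proof.
move=> a x y; rewrite -[x]quot_reprK -[y]quot_reprK.
move: (repr x) (repr y) => p q.
rewrite -(quot_piD I p q) (quot_scaleE a p) (quot_scaleE a q) (quot_scaleE a).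
by rewrite scalerDr quot_piD.
Qed.

Lemma quot_scaleDl x : {morph quot_scale^~ x : a b / a + b}.
Proof.
move=> a b; rewrite -[x]quot_reprK; move: (repr x) => p.
by rewrite !(quot_scaleE _ p) scalerDl quot_piD.
Qed.

HB.instance Definition _ := GRing.Zmodule_isLmodule.Build K Q
  quot_scaleA quot_scale1 quot_scaleDr quot_scaleDl.

Lemma quot_piZ a (p : {mpoly K[n]}) : quot_pi I (a *: p) = a *: quot_pi I p.
Proof. by rewrite -quot_scaleE. Qed.

Definition quot_graded (i : nat) (r : Q) : Prop :=
  exists2 p : {mpoly K[n]}, p \is i.-homog & r = quot_pi I p.
End QuotModule.

Definition has_dim (K : fieldType) (V : lmodType K) (W : V -> Prop) (d : nat) :
    Prop :=
  exists2 f : {linear 'rV[K]_d -> V},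
    injective f & forall v, W v <-> exists u, f u = v.

(* For linear f, being injective or surjective is having full rank. *)
Definition full_rank_between (V : Type) (A B : V -> Prop) (f : V -> V) : Prop :=
  (forall x y, A x -> A y -> f x = f y -> x = y) \/
  (forall y, B y -> exists2 x, A x & f x = y).

Definition strong_Lefschetz (R : comPzRingType) (gr : nat -> R -> Prop) : Prop :=
  exists2 l : R, gr 1%N l &
    forall i s : nat, (0 < s)%N ->
      full_rank_between (gr i) (gr (i + s)%N) (fun r => l ^+ s * r).

Section MonomialIdeals.
Variables (n : nat) (K : fieldType).
Implicit Types (I : ideal {mpoly K[n]}) (M : 'X_{1..n} -> Prop).

Definition quot_SLP I : Prop :=
  strong_Lefschetz (fun i (r : quot_ring I) => quot_graded i r).

(* d is the value at i of the Hilbert function of K[x_1..x_n] / I. *)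
Definition hilbert_value I (i d : nat) : Prop :=
  has_dim (fun r : quot_ring I => quot_graded i r) d.

Definition same_hilbert_function I I' : Prop :=
  forall i d, hilbert_value I i d <-> hilbert_value I' i d.

Definition generates M I : Prop :=
  forall p : {mpoly K[n]}, p \in I <->
    exists (k : nat) (a : 'I_k -> {mpoly K[n]}) (m : 'I_k -> 'X_{1..n}),
      (forall j, M (m j)) /\ p = \sum_(j < k) a j * 'X_[m j].

Definition monomial_ideal I : Prop := exists M, generates M I.

Definition minimally_generates M I : Prop :=
  generates M I /\
  forall M', (forall t, M' t -> M t) -> generates M' I -> forall t, M t -> M' t.

Definition strongly_stable I : Prop :=
  monomial_ideal I /\
  forall (t : 'X_{1..n}) (i j : 'I_n), 'X_[t] \in I -> (i < j)%N ->
    (U_(j) <= t)%MM -> 'X_[(U_(i) + (t - U_(j)))%MM] \in I.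

(* degrevlex_lt t t' : t < t' for the degree reverse lexicographic order with
   x_1 > ... > x_n.  The library's order on monomials, although documented as
   degrevlex, compares exponents from the first variable on, i.e. is deglex. *)
Definition degrevlex_lt (t t' : 'X_{1..n}) : Prop :=
  (mdeg t < mdeg t')%N \/
  mdeg t = mdeg t' /\
  exists k : 'I_n, (t' k < t k)%N /\ forall j : 'I_n, (k < j)%N -> t' j = t j.

Definition almost_revlex I : Prop :=
  exists2 M, minimally_generates M I &
    forall t, M t -> forall t' : 'X_{1..n},
      mdeg t' = mdeg t -> degrevlex_lt t t' -> 'X_[t'] \in I.
End MonomialIdeals.

(* Main.v *)
Require Import Defs.
From HB Require Import structures.
From mathcomp Require Import all_boot all_order all_algebra.

(** Write z for the last variable.

    The Lefschetz element can be taken to be z ([stable_SLP_last_var]).  Let l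
    be a linear form such that l^s : (S/I)_i -> (S/I)_(i+s) has full rank.
    If it is injective, so is z^s: stability gives l^s t \in I as soon as
    z^s t \in I, because l^s t is a combination of monomials got from z^s t by
    lowering variables.  If it is surjective, let x_k be the last variable
    occurring in l.  The substitution sending l to x_k and fixing the other
    variables preserves I, so x_k^s is surjective as well, which means that x_k^s
    divides every standard monomial of degree i + s.  If z^s did not divide such
    a monomial t, exchanging the exponents of x_k and z in t would give a
    monomial which is standard by stability and not divisible by x_k^s.  Hence
    z^s is surjective.  The form l itself need not involve z, so no genericity
    argument is used.

    I is almost revlex ([stable_SLP_revlex_closed]).  Let t be a minimal
    generator and t' > t of the same degree.  If z has the same exponent in t
    and t', then t' is got from t by replacing some y by x.  Otherwise, let s be
    one more than the exponent of z in t'.  Then z^s divides t, and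
    t / z^s \notin I by minimality, so z^s is not injective in that degree; it
    is therefore surjective, and as z^s does not divide t', t' \in I.

    I is determined by its Hilbert function ([revlex_closed_hilbert_eq]).
    If I and I' agree in degrees below d, then a monomial of degree d in I but
    not in I' is a minimal generator of I, and vice versa.  As degrevlex is
    total, such monomials cannot exist on both sides, so one of the degree d
    parts contains the other; the dimensions being equal, they coincide. *)

Set Implicit Arguments.
Unset Strict Implicit.
Unset Printing Implicit Defensive.

Import GRing.Theory.

(** * Monomial ideals and their minimal generators *)

Section MonomialIdealTheory.
Local Open Scope ring_scope.
Variables (n : nat) (K : fieldType).
Implicit Types (I : ideal {mpoly K[n]}) (p q r : {mpoly K[n]}) (t u : 'X_{1..n}).

Lemma idealZ I (c : K) p : p \in I -> c *: p \in I.
Proof. by rewrite -mul_mpolyC; apply: idealM. Qed.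

Lemma mem_ideal_leX I t u : (t <= u)%MM -> 'X_[t] \in I -> 'X_[u] \in I.
Proof. by move=> /submK <- tI; rewrite mpolyXD; apply: idealM. Qed.

Lemma generates_mem (M : 'X_{1..n} -> Prop) I t :
  generates M I -> M t -> 'X_[t] \in I.
Proof.
move=> genI Mt; apply/genI; exists 1%N, (fun=> 1), (fun=> t).
by rewrite big_ord1 mul1r.
Qed.

Lemma generates_dvd (M : 'X_{1..n} -> Prop) I p t :
  generates M I -> p \in I -> t \in msupp p -> exists2 u, M u & (u <= t)%MM.
Proof.
move=> genI /genI[k [a [m [Mm ->]]]] /msupp_sum_le /flatten_mapP[j _].
rewrite (perm_mem (msuppMX _ _)) => /mapP[v _ ->].
by exists (m j); rewrite ?lem_addr.
Qed.

(** A monomial ideal contains every monomial of each of its elements; together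
    with [supp_mem_ideal] this reduces membership to monomials. *)
Lemma monomial_ideal_supp I p t :
  monomial_ideal I -> p \in I -> t \in msupp p -> 'X_[t] \in I.
Proof.
case=> M genI pI /(generates_dvd genI pI)[u Mu le_ut].
exact: mem_ideal_leX le_ut (generates_mem genI Mu).
Qed.

Lemma supp_mem_ideal I p :
  (forall t, t \in msupp p -> 'X_[t] \in I) -> p \in I.
Proof.
move=> suppI; rewrite (mpolyE p) big_seq; apply: rpred_sum => t tp.
by apply: idealZ; apply: suppI.
Qed.

(** t is a minimal monomial of I for divisibility. *)
Definition min_generator I t : Prop :=
  'X_[t] \in I /\ forall u, 'X_[u] \in I -> (u <= t)%MM -> u = t.

Lemma lem_mdeg_eq t u : (u <= t)%MM -> (mdeg t <= mdeg u)%N -> u = t.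
Proof.
move=> le_ut; have := submK le_ut; move: (t - u)%MM => v <-.
rewrite mdegD -{2}[mdeg u]add0n leq_add2r leqn0 mdeg_eq0 => /eqP->.
by rewrite add0m.
Qed.

Lemma min_generator_dvd I t :
  'X_[t] \in I -> exists2 u, min_generator I u & (u <= t)%MM.
Proof.
have [d] := ubnP (mdeg t); elim: d t => // d IHd t lt_td tI.
have [/existsP[i /andP[le_it uI]]|no_div] :=
  boolP [exists i, (U_(i) <= t)%MM && ('X_[t - U_(i)] \in I)].
  have [|u gen_u le_u] := IHd (t - U_(i))%MM _ uI.
    by move: lt_td; rewrite -{1}(submK le_it) mdegD mdeg1 addn1.
  by exists u => //; apply: lepm_trans le_u (lem_subr _ _).
exists t; rewrite ?lepm_refl //; split=> // u uI le_ut.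
apply/eqP/negPn/negP => ne_ut; case/negP: no_div.
have [i lt_i] : exists i, (u i < t i)%N.
  have [/existsP//|] := boolP [exists i, (u i < t i)%N].
  rewrite negb_exists => /forallP ge_ut.
  case/eqP: ne_ut; apply/mnmP => i; apply/eqP.
  by rewrite eqn_leq (mnm_lepP le_ut) leqNgt ge_ut.
apply/existsP; exists i; rewrite lep1mP -lt0n (leq_ltn_trans _ lt_i) //=.
apply: mem_ideal_leX uI; apply/mnm_lepP => j; rewrite mnmBE mnm1E.
case: eqP => [<-|_]; rewrite ?subn0 ?(mnm_lepP le_ut) //.
by rewrite subn1 -ltnS (ltn_predK lt_i).
Qed.

Lemma min_generators_minimally_generate I :
  monomial_ideal I -> minimally_generates (min_generator I) I.
Proof.
move=> monoI; split=> [p|M' subM genM' t [tI min_t]]; last first.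
  have [|u M'u le_ut] := generates_dvd genM' tI (t := t).
    by rewrite msuppX mem_seq1.
  by rewrite -(min_t u) //; apply: generates_mem M'u.
split=> [pI|[k [a [m [gen_m ->]]]]]; last first.
  by apply: rpred_sum => j _; apply: idealM; case: (gen_m j).
pose s := msupp p.
have /fin_all_exists2[m gen_m le_m] (j : 'I_(size s)) :
    exists2 u, min_generator I u & (u <= nth 0%MM s j)%MM.
  by apply/min_generator_dvd/(monomial_ideal_supp monoI pI)/mem_nth.
exists (size s),
  (fun j : 'I_(size s) => p@_(nth 0%MM s j) *: 'X_[nth 0%MM s j - m j]), m.
split=> //; rewrite {1}(mpolyE p) (big_nth 0%MM) big_mkord.
apply: eq_bigr => j _.
by rewrite -scalerAl -mpolyXD submK.
Qed.

(** * Substitutions in strongly stable ideals *)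

Lemma linear_formE p : p \is 1.-homog -> p = \sum_j p@_U_(j) *: 'X_j.
Proof.
move=> hom_p; apply/mpolyP => m; rewrite raddf_sum /=.
under eq_bigr do rewrite mcoeffZ mcoeffX.
have [/mdeg1P[i /eqP->]|ne1] := boolP (mdeg m == 1%N).
  rewrite (bigD1 i) //= eqxx mulr1 big1 ?addr0 // => j ne_ji.
  case: eqP => [/mnmP/(_ i)|_]; last by rewrite mulr0.
  by rewrite !mnm1E eqxx (negPf ne_ji).
rewrite (dhomog_nemf_coeff hom_p ne1) big1 // => j _.
have [def_m|_] := U_(j)%MM =P m; last by rewrite mulr0.
by rewrite -def_m mdeg1 in ne1.
Qed.

Lemma stable_lower I t (i j : 'I_n) : strongly_stable I -> (i <= j)%N ->
  'X_[U_(j) + t] \in I -> 'X_[U_(i) + t] \in I.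
Proof.
case=> _ stabI; rewrite leq_eqVlt => /orP[/eqP/val_inj-> //|lt_ij] tI.
have := stabI _ _ _ tI lt_ij; rewrite [(U_(j) + t)%MM]addmC addmK; apply.
exact: lem_addl.
Qed.

(** If x_k^s t is in I, so is l^s t for every linear form l in x_1, ..., x_k. *)
Lemma stable_linear_power I t (k : 'I_n) (c : 'I_n -> K) s :
  strongly_stable I -> 'X_[U_(k) *+ s + t] \in I ->
  (\sum_(j < n | (j <= k)%N) c j *: 'X_j) ^+ s * 'X_[t] \in I.
Proof.
move=> stabI; elim: s t => [|s IHs] t.
  by rewrite mulm0n add0m expr0 mul1r.
rewrite mulmS -addmA exprSr -mulrA => tI.
rewrite mulr_suml mulr_sumr; apply: rpred_sum => j le_jk.
rewrite -scalerAl -scalerAr -mpolyXD; apply/idealZ/IHs.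
by rewrite addmA [(_ + U_(j))%MM]addmC -addmA; apply: stable_lower tI.
Qed.

Lemma stable_lowerMn I t (i j : 'I_n) s : strongly_stable I -> (i <= j)%N ->
  'X_[U_(j) *+ s + t] \in I -> 'X_[U_(i) *+ s + t] \in I.
Proof.
move=> stabI le_ij tI.
(* The linear form is x_i here. *)
have := @stable_linear_power _ _ _ (fun k => (k == i)%:R) _ stabI tI.
rewrite (bigD1 i) //= eqxx scale1r big1 ?addr0 => [|k /andP[_ /negPf->]].
  by rewrite mpolyXn -mpolyXD.
by rewrite scale0r.
Qed.

(** The values of the substitution sending x_k to g and fixing the other
    variables. *)
Definition subst_var (k : 'I_n) (g : {mpoly K[n]}) : n.-tuple {mpoly K[n]} :=
  [tuple if j == k then g else 'X_j | j < n].

Lemma subst_var_monomial (k : 'I_n) g a t : t k = 0%N ->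
  'X_[U_(k) *+ a + t] \mPo subst_var k g = g ^+ a * 'X_[t].
Proof.
move=> tk0; rewrite comp_mpolyX (bigD1 k) //= tnth_mktuple eqxx mnmDE mulmnE.
rewrite mnm1E eqxx mul1n tk0 addn0; congr (_ * _).
rewrite (mpolyXE_id _ t) [RHS](bigD1 k) //= tk0 expr0 mul1r.
apply: eq_bigr => j ne_jk; rewrite tnth_mktuple (negPf ne_jk) mnmDE mulmnE.
by rewrite mnm1E eq_sym (negPf ne_jk).
Qed.

Lemma mnm_split t (k : 'I_n) :
  exists2 u, t = (U_(k) *+ t k + u)%MM & u k = 0%N.
Proof.
exists (t - U_(k) *+ t k)%MM; last first.
  by rewrite mnmBE mulmnE mnm1E eqxx mul1n subnn.
rewrite addmC submK //; apply/mnm_lepP => j; rewrite mulmnE mnm1E.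
by case: eqP => [->|_]; rewrite ?mul1n.
Qed.

(** A strongly stable ideal is preserved by the substitutions replacing x_k by a
    linear form in x_1, ..., x_k. *)
Lemma stable_subst_var I (k : 'I_n) (c : 'I_n -> K) p : strongly_stable I ->
  p \in I -> p \mPo subst_var k (\sum_(j < n | (j <= k)%N) c j *: 'X_j) \in I.
Proof.
move=> stabI pI; rewrite (mpolyE p) raddf_sum big_seq; apply: rpred_sum.
move=> t /(monomial_ideal_supp (proj1 stabI) pI) tI; rewrite /= comp_mpolyZ.
apply: idealZ; have [u def_t uk0] := mnm_split t k.
rewrite def_t subst_var_monomial //; apply: stable_linear_power => //.
by rewrite -def_t.
Qed.

(** If multiplication by l^s is onto the degree i + s part of the quotient, where
    l is a linear form whose last variable is x_k, then x_k^s divides every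
    standard monomial of degree i + s.  The reason is that a substitution which
    preserves I maps l to x_k. *)
Lemma surjective_power_dvd I (k : 'I_n) (c : 'I_n -> K) i s t :
    let l := \sum_(j < n | (j <= k)%N) c j *: 'X_j in
    strongly_stable I -> c k != 0 ->
    (forall q, q \is (i + s).-homog ->
       exists2 r : {mpoly K[n]}, r \is i.-homog & l ^+ s * r - q \in I) ->
  mdeg t = (i + s)%N -> 'X_[t] \notin I -> (s <= t k)%N.
Proof.
move=> l stabI ck_neq0 surj deg_t; apply: contraR; rewrite -ltnNge => lt_tk.
(* The coefficients of the linear form whose substitution for x_k sends l
   to x_k. *)
pose d j := if j == k then (c k)^-1 else - ((c k)^-1 * c j).
pose psi := comp_mpoly (subst_var k (\sum_(j < n | (j <= k)%N) d j *: 'X_j)).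
have psiZ a q : psi (a *: q) = a *: psi q by apply: comp_mpolyZ.
have psi_var j : j != k -> psi 'X_j = 'X_j.
  move=> ne_jk; have := @subst_var_monomial k
    (\sum_(j < n | (j <= k)%N) d j *: 'X_j) 0 U_(j)%MM.
  by rewrite mulm0n add0m expr0 mul1r; apply; rewrite mnm1E (negPf ne_jk).
have psi_l : psi l = 'X_k.
  rewrite /l {1}/psi raddf_sum /= -/psi (bigD1 k) //= psiZ.
  have -> : psi 'X_k = \sum_(j < n | (j <= k)%N) d j *: 'X_j.
    have := @subst_var_monomial k (\sum_(j < n | (j <= k)%N) d j *: 'X_j) 1 0%MM.
    by rewrite mulm1n addm0 expr1 mpolyX0 mulr1; apply; rewrite mnm0E.
  rewrite [in X in _ *: X](bigD1 k) //= scalerDr scalerA /d eqxx divff //.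
  rewrite scale1r -addrA scaler_sumr -big_split big1 ?addr0 //= => j /andP[_ ne_jk].
  rewrite (negPf ne_jk) psiZ psi_var // scalerA mulrN mulrA divff //.
  by rewrite mul1r scaleNr addNr.
have [u def_t uk0] := mnm_split t k.
have hom_l : l \is 1.-homog.
  by apply: rpred_sum => j _; apply: rpredZ; rewrite dhomogX /= mdeg1.
(* The substitution psi maps this element l^(t k) u to t. *)
have [|r _ lrI] := surj (l ^+ t k * 'X_[u]).
  rewrite -deg_t {2}def_t mdegD mdegMn mdeg1; apply: dhomogM.
    exact: dhomogMn.
  by rewrite dhomogX.
have := @stable_subst_var I k d _ stabI lrI.
rewrite raddfB /= !rmorphM !rmorphXn /= -/psi psi_l.
have -> : psi 'X_[u] = 'X_[u].
  have := @subst_var_monomial k (\sum_(j < n | (j <= k)%N) d j *: 'X_j) 0 u uk0.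
  by rewrite mulm0n add0m expr0 mul1r.
rewrite !mpolyXn -mpolyXD -def_t => /(monomial_ideal_supp (proj1 stabI)); apply.
rewrite mcoeff_msupp mcoeffB mcoeffX eqxx.
(* As t k < s, the monomial t does not occur in a multiple of x_k^s, so it
   survives in the difference. *)
rewrite (_ : _@_t = 0) ?sub0r ?oppr_eq0 ?oner_eq0 //.
apply/eqP; rewrite mcoeff_eq0 mulrC (perm_mem (msuppMX _ _)).
apply/mapP => -[v _ /mnmP/(_ k)]; rewrite mnmDE mulmnE mnm1E eqxx mul1n => def_tk.
by move: lt_tk; rewrite def_tk ltnNge leq_addr.
Qed.

End MonomialIdealTheory.

(** * The last variable as a Lefschetz element *)

Section LefschetzElement.
Local Open Scope ring_scope.
Variables (n : nat) (K : fieldType).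
Implicit Types (I : ideal {mpoly K[n.+1]}) (t u : 'X_{1..n.+1}).

Lemma quot_piX I p s : quot_pi I (p ^+ s) = quot_pi I p ^+ s.
Proof.
elim: s => [//|s IHs].
by rewrite !exprS -IHs; apply: quot_piM.
Qed.

Lemma quot_pi_eq0 I p : quot_pi I p = quot_pi I 0 <-> p \in I.
Proof. by rewrite -[p in p \in I]subr0; apply: quot_piP. Qed.

(** Multiplication by z^s is injective or surjective in each degree, expressed on
    monomials. *)
Lemma stable_SLP_last_var I : strongly_stable I -> quot_SLP I ->
  forall i s, (0 < s)%N ->
    (forall t, mdeg t = i -> 'X_[U_(ord_max) *+ s + t] \in I -> 'X_[t] \in I) \/
    (forall t, mdeg t = (i + s)%N -> 'X_[t] \notin I -> (s <= t ord_max)%N).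
Proof.
move=> stabI [_ [p hom_p ->] full] i s s_gt0; have def_p := linear_formE hom_p.
have [inj|surj] := full i s s_gt0; [left=> t deg_t ztI | right=> t deg_t].
  apply/quot_pi_eq0; apply: inj.
  - by exists 'X_[t] => //; rewrite dhomogX /= deg_t.
  - by exists 0 => //; apply: dhomog0.
  rewrite -quot_piX -!quot_piM mulr0; apply/quot_pi_eq0.
  have ->: p = \sum_(j < n.+1 | (j <= @ord_max n)%N) p@_U_(j) *: 'X_j.
    by rewrite [LHS]def_p; apply: eq_bigl => j; rewrite leq_ord.
  exact: stable_linear_power.
have {}surj q : q \is (i + s).-homog ->
    exists2 r : {mpoly K[n.+1]}, r \is i.-homog & p ^+ s * r - q \in I.
  move=> hom_q; have [|_ [r hom_r ->] def_q] := surj (quot_pi I q).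
    by exists q.
  by exists r => //; apply/quot_piP; rewrite quot_piM quot_piX.
have [j0 pj0|p0] := pickP (fun j => p@_U_(j) != 0); last first.
  (* For l = 0, surjectivity puts every monomial of degree i + s in I. *)
  apply: contraNT => _; have [|r _] := surj 'X_[t].
    by rewrite dhomogX /= deg_t.
  rewrite def_p big1 => [|j _]; last first.
    by move/negbFE/eqP: (p0 j) => ->; rewrite scale0r.
  by rewrite expr0n -[s]prednK //= mul0r sub0r rpredN.
case: (@arg_maxnP _ j0 (fun j => p@_U_(j) != 0) val pj0) => k pk0 max_k.
have dvd_k t' : mdeg t' = (i + s)%N -> 'X_[t'] \notin I -> (s <= t' k)%N.
  apply: (surjective_power_dvd (c := fun j => p@_U_(j))) => // q hom_q.
  have [r hom_r prI] := surj q hom_q; exists r => //.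
  rewrite -(_ : p = \sum_(j < n.+1 | (j <= k)%N) p@_U_(j) *: 'X_j) //.
  rewrite [LHS]def_p (bigID (fun j : 'I_n.+1 => (j <= k)%N)) /=.
  rewrite [X in _ + X]big1 ?addr0 // => j; apply: contraNeq => nz.
  by apply: max_k; apply: contraNneq nz => ->; rewrite scale0r.
move=> tI; rewrite leqNgt; apply/negP => lt_ts.
have le_sk := dvd_k t deg_t tI.
(* Replacing e copies of x_k by z in t exchanges the exponents of x_k and z. *)
pose e := (t k - t ord_max)%N; pose w := (t - U_(k) *+ e)%MM.
have def_t : t = (U_(k) *+ e + w)%MM.
  rewrite addmC submK //; apply/mnm_lepP => j; rewrite mulmnE mnm1E.
  by case: eqP => [<-|_]; rewrite ?mul1n ?leq_subr.
have: (s <= (U_(ord_max) *+ e + w)%MM k)%N.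
  apply: dvd_k.
    by rewrite -deg_t [in RHS]def_t !mdegD !mdegMn !mdeg1.
  apply: contra tI; rewrite [in X in _ -> X]def_t; apply: stable_lowerMn => //.
  exact: leq_ord.
rewrite mnmDE mnmBE !mulmnE !mnm1E eqxx mul1n.
have [def_k|_] := ord_max =P k.
  by move: (leq_trans lt_ts le_sk); rewrite def_k ltnn.
rewrite mul0n add0n subKn; last exact: ltnW (leq_trans lt_ts le_sk).
by rewrite leqNgt lt_ts.
Qed.

(** A minimal generator t shows that z^s is not injective from degree
    deg t - s for every s between 1 and the exponent of z in t; surjectivity
    for s = (t' ord_max).+1 then gives the claim. *)
Lemma min_generator_last_var I t t' : strongly_stable I -> quot_SLP I ->
  min_generator I t -> mdeg t' = mdeg t -> (t' ord_max < t ord_max)%N ->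
  'X_[t'] \in I.
Proof.
move=> stabI slpI [tI min_t] eq_deg lt_t'; set s := (t' ord_max).+1.
pose u := (t - U_(ord_max) *+ s)%MM.
have def_t : t = (U_(ord_max) *+ s + u)%MM.
  rewrite addmC submK //; apply/mnm_lepP => j; rewrite mulmnE mnm1E.
  by case: eqP => [<-|_]; rewrite ?mul1n.
have deg_t : mdeg t = (mdeg u + s)%N.
  by rewrite {1}def_t mdegD mdegMn mdeg1 mul1n addnC.
case: (stable_SLP_last_var stabI slpI (mdeg u) (ltn0Sn (t' ord_max))).
  move=> /(_ u erefl); rewrite -/s -def_t => /(_ tI) uI.
  have := deg_t; rewrite (min_t _ uI (lem_subr _ _)).
  by move/eqP; rewrite -{1}[mdeg t]addn0 eqn_add2l.
move=> /(_ t'); rewrite eq_deg => /(_ deg_t) dvd_t'.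
by apply/negPn/negP => /dvd_t'; rewrite ltnn.
Qed.

End LefschetzElement.

(** * The almost revlex property *)

Section DegRevLex.
Local Open Scope ring_scope.
Variables (n : nat) (K : fieldType).
Implicit Types (I : ideal {mpoly K[n]}) (t u : 'X_{1..n}).

Lemma degrevlex_total t u : mdeg t = mdeg u -> t <> u ->
  degrevlex_lt t u \/ degrevlex_lt u t.
Proof.
move=> eq_deg /eqP ne_tu; have [j0 nej0|eq_tu] := pickP (fun j => t j != u j).
  case: (@arg_maxnP _ j0 (fun j => t j != u j) val nej0) => k ne_k max_k.
  have eq_gt (j : 'I_n) : (k < j)%N -> t j = u j.
    by move=> lt_kj; apply/eqP; apply: contraLR lt_kj => /max_k; rewrite -leqNgt.
  case: ltngtP ne_k => // [lt_k|gt_k] _; [right|left]; right; split=> //.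
    by exists k.
  by exists k; split=> // j /eq_gt.
by case/eqP: ne_tu; apply/mnmP => j; apply/eqP/negPn; rewrite eq_tu.
Qed.

(** The condition of [almost_revlex], for the minimal monomials of I instead of an
    existentially quantified minimal generating set. *)
Definition revlex_closed I : Prop :=
  forall t, min_generator I t -> forall t',
    mdeg t' = mdeg t -> degrevlex_lt t t' -> 'X_[t'] \in I.

End DegRevLex.

Lemma stable_SLP_revlex_closed (K : fieldType) (I : ideal {mpoly K[3]}) :
  strongly_stable I -> quot_SLP I -> revlex_closed I.
Proof.
move=> stabI slpI t gen_t t' eq_deg [|[_ [k [lt_k eq_gt]]]].
  by rewrite eq_deg ltnn.
have [def_k|ne_k2] := eqVneq k ord_max.
  by apply: min_generator_last_var gen_t eq_deg _; rewrite // -def_k.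
pose x : 'I_3 := ord0; pose y : 'I_3 := inord 1; pose z : 'I_3 := ord_max.
have vars (j : 'I_3) : [\/ j = x, j = y | j = z].
  case: j => [[|[|[|//]]] lt_j]; [apply: Or31|apply: Or32|apply: Or33];
  by apply: val_inj => //=; rewrite inordK.
have degE (m : 'X_{1..3}) : mdeg m = (m x + m y + m z)%N.
  rewrite mdegE !big_ord_recr big_ord0 /= add0n; congr (_ + _ + _)%N.
    by apply: (congr1 m); apply: val_inj.
  by apply: (congr1 m); apply: val_inj; rewrite /= inordK.
have eq_z : t' z = t z.
  apply: eq_gt; rewrite ltn_neqAle leq_ord andbT.
  by apply: contra ne_k2 => /eqP/val_inj->.
have [def_k|def_k|] := vars k; last by move/eqP; rewrite (negPf ne_k2).
  have eq_y : t' y = t y by apply: eq_gt; rewrite def_k /= inordK.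
  move: lt_k; rewrite def_k => lt_x; move: eq_deg.
  by rewrite !degE eq_y eq_z => /addIn/addIn eq_x; rewrite eq_x ltnn in lt_x.
rewrite {}def_k in lt_k; pose e := (t y - t' y)%N.
have ne_yx : (y == x) = false by apply/eqP => /(congr1 val); rewrite /= inordK.
have ne_zx : (x == z) = false by [].
have ne_yz : (y == z) = false by apply/eqP => /(congr1 val); rewrite /= inordK.
have def_e : t y = (e + t' y)%N by rewrite subnK // ltnW.
pose w := (t - U_(y) *+ e)%MM.
have -> : t' = (U_(x) *+ e + w)%MM.
  move: eq_deg; rewrite !degE eq_z def_e => /addIn.
  rewrite addnA => /addIn eq_x; apply/mnmP => j.
  rewrite mnmDE mnmBE !mulmnE !mnm1E.
  case: (vars j) => ->; rewrite ?eqxx ?ne_zx ?ne_yx ?ne_yz ?[x == y]eq_sym ?ne_yx.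
  - by rewrite mul1n mul0n subn0 eq_x addnC.
  - by rewrite mul0n mul1n def_e addKn.
  - by rewrite !mul0n subn0.
apply: (@stable_lowerMn _ _ _ _ x y) => //.
rewrite addmC submK; first by case: gen_t.
apply/mnm_lepP => j; rewrite mulmnE mnm1E.
by case: eqP => [<-|_]; rewrite ?mul1n ?leq_subr.
Qed.

(** * The Hilbert function determines a revlex-closed monomial ideal *)

Section HilbertFunction.
Local Open Scope ring_scope.

(** In particular the dimension given by [has_dim] is unique. *)
Lemma has_dim_leq (K : fieldType) (V : lmodType K) (W : V -> Prop) (a b : nat) :
  has_dim W a -> has_dim W b -> (b <= a)%N.
Proof.
case=> f _ imf [g inj_g img].
have /fin_all_exists[m def_m] (j : 'I_b) : exists u, f u = g (delta_mx 0 j).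
  by apply/imf/img; exists (delta_mx 0 j).
have fmE v : f (v *m \matrix_j m j) = g v.
  rewrite mulmx_sum_row linear_sum [in RHS](row_sum_delta v) linear_sum.
  by apply: eq_bigr => j _; rewrite rowK !linearZ def_m.
suff /eqP <- : row_free (\matrix_j m j) by apply: rank_leq_col.
apply: inj_row_free => v vm0; apply: inj_g.
by rewrite -fmE vm0 !linear0.
Qed.

Variables (n : nat) (K : fieldType).
Implicit Types (I : ideal {mpoly K[n]}) (t u : 'X_{1..n}).

(** The monomials of degree d outside I.  The sequence ranges over the finite type
    of the monomials of degree less than d.+1. *)
Definition standard_monomials I d : seq 'X_{1..n} :=
  [seq t <- [seq bmnm u | u : 'X_{1..n < d.+1}] |
     (mdeg t == d) && ('X_[t] \notin I)].

Lemma mem_standard_monomials I d t :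
  (t \in standard_monomials I d) = (mdeg t == d) && ('X_[t] \notin I).
Proof.
rewrite mem_filter andb_idr // => /andP[/eqP deg_t _].
have lt_td : (mdeg t < d.+1)%N by rewrite deg_t.
exact: (image_f (@bmnm n d.+1) (isT : BMultinom lt_td \in predT)).
Qed.

Lemma standard_monomials_uniq I d : uniq (standard_monomials I d).
Proof. by rewrite filter_uniq // map_inj_uniq ?enum_uniq //; apply: val_inj. Qed.

Section StandardCombination.
Variables (I : ideal {mpoly K[n]}) (d : nat).
Local Notation N := (size (standard_monomials I d)).

Definition standard_poly (v : 'rV[K]_N) : {mpoly K[n]} :=
  \sum_(j < N) v 0 j *: 'X_[nth 0%MM (standard_monomials I d) j].

(** The class of a combination of standard monomials, with the coefficients given
    as a row vector; it identifies the degree d part of the quotient with a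
    space of row vectors. *)
Definition standard_comb (v : 'rV[K]_N) : quot_ring I :=
  quot_pi I (standard_poly v).

Lemma standard_comb_linear : linear standard_comb.
Proof.
move=> a u v; rewrite /standard_comb -quot_piZ -quot_piD; congr quot_pi.
rewrite /standard_poly scaler_sumr -big_split; apply: eq_bigr => j _ /=.
by rewrite !mxE scalerDl scalerA.
Qed.

HB.instance Definition _ := GRing.isLinear.Build K 'rV[K]_N (quot_ring I)
  *:%R standard_comb standard_comb_linear.

Lemma coef_standard_poly v (j : 'I_N) :
  (standard_poly v)@_(nth 0%MM (standard_monomials I d) j) = v 0 j.
Proof.
rewrite raddf_sum (bigD1 j) //= mcoeffZ mcoeffX eqxx mulr1 big1 ?addr0 // => i.
rewrite mcoeffZ mcoeffX nth_uniq ?standard_monomials_uniq // => /negPf ne_ij.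
by rewrite (inj_eq val_inj) ne_ij mulr0.
Qed.

Lemma hilbert_value_standard : monomial_ideal I -> hilbert_value I d N.
Proof.
move=> monoI; exists standard_comb => [u v /quot_piP uvI|r].
  apply/rowP => j; apply/eqP; rewrite -subr_eq0 -!coef_standard_poly -mcoeffB.
  have: nth 0%MM (standard_monomials I d) j \in standard_monomials I d.
    exact: mem_nth.
  rewrite mem_standard_monomials => /andP[_]; apply: contraR => nz.
  by apply: (monomial_ideal_supp monoI uvI); rewrite mcoeff_msupp.
split=> [[p hom_p ->]|[v <-]]; last first.
  exists (standard_poly v) => //; apply: rpred_sum => j _; apply: rpredZ.
  have: nth 0%MM (standard_monomials I d) j \in standard_monomials I d.
    exact: mem_nth.
  by rewrite mem_standard_monomials dhomogX => /andP[].
exists (\row_j p@_(nth 0%MM (standard_monomials I d) j)); apply/quot_piP.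
apply: supp_mem_ideal => t tS; apply/negPn/negP => tI.
move: tS; rewrite mcoeff_msupp mcoeffB; case/negP.
have [deg_t|ne_deg] := eqVneq (mdeg t) d.
  have tS : t \in standard_monomials I d.
    by rewrite mem_standard_monomials deg_t eqxx.
  have lt_tS := tS; rewrite -index_mem in lt_tS; rewrite -(nth_index 0%MM tS).
  by rewrite (coef_standard_poly _ (Ordinal lt_tS)) mxE subrr.
rewrite [p@_t](dhomog_nemf_coeff hom_p) // subr0 raddf_sum big1 // => j _.
rewrite /= mcoeffZ mcoeffX; have [def_t|_] := eqP; last by rewrite mulr0.
case/negP: ne_deg; rewrite -def_t.
have: nth 0%MM (standard_monomials I d) j \in standard_monomials I d.
  exact: mem_nth.
by rewrite mem_standard_monomials => /andP[].
Qed.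

End StandardCombination.

Lemma same_hilbert_standard I I' d : monomial_ideal I -> monomial_ideal I' ->
  same_hilbert_function I' I ->
  size (standard_monomials I d) = size (standard_monomials I' d).
Proof.
move=> monoI monoI' /(_ d _) hilb.
have hI := hilbert_value_standard d monoI.
have /hilb hI' := hilbert_value_standard d monoI'.
by apply/eqP; rewrite eqn_leq (has_dim_leq hI hI') (has_dim_leq hI' hI).
Qed.

(** A monomial t of I outside I' would force I' to be contained in I in degree d,
    by comparison of minimal generators in the degrevlex order; the inclusion
    would be strict, against the equality of the dimensions. *)
Lemma revlex_closed_degree_sub I I' d :
    revlex_closed I -> revlex_closed I' ->
    (forall t, (mdeg t < d)%N -> ('X_[t] \in I) = ('X_[t] \in I')) ->
    size (standard_monomials I d) = size (standard_monomials I' d) ->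
  forall t, mdeg t = d -> 'X_[t] \in I -> 'X_[t] \in I'.
Proof.
move=> rlI rlI' eq_lt eq_size t deg_t tI; apply/negPn/negP => tI'.
(* A monomial of degree d in one ideal and not in the other is a minimal
   generator, since the ideals agree in lower degrees. *)
have new_gen (J J' : ideal {mpoly K[n]}) u :
    (forall t, (mdeg t < d)%N -> 'X_[t] \in J -> 'X_[t] \in J') ->
    mdeg u = d -> 'X_[u] \in J -> 'X_[u] \notin J' -> min_generator J u.
  move=> subJ deg_u uJ uJ'; split=> // v vJ le_vu; apply: lem_mdeg_eq => //.
  rewrite leqNgt deg_u; apply: contra uJ' => /subJ/(_ vJ).
  exact: mem_ideal_leX.
have gen_t : min_generator I t by apply: new_gen tI' => // u /eq_lt->.
have sub_d u : mdeg u = d -> 'X_[u] \in I' -> 'X_[u] \in I.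
  move=> deg_u uI'; apply/negPn/negP => uI.
  have gen_u : min_generator I' u by apply: new_gen uI => // v /eq_lt->.
  have [|eq_tu|lt_tu|lt_ut] := @degrevlex_total _ t u.
  - by rewrite deg_t.
  - by rewrite -eq_tu tI in uI.
  - by rewrite (rlI t gen_t u) ?deg_t in uI.
  - by rewrite (rlI' u gen_u t) ?deg_t in tI'.
have sub_std : {subset standard_monomials I d <= standard_monomials I' d}.
  move=> u; rewrite !mem_standard_monomials => /andP[/eqP deg_u uI].
  by rewrite deg_u eqxx; apply: contra uI; apply: sub_d.
have [_ eq_std] := uniq_min_size (standard_monomials_uniq I d) sub_std
  (eq_leq (esym eq_size)).
by have := eq_std t; rewrite !mem_standard_monomials deg_t eqxx tI tI'.
Qed.

Lemma revlex_closed_hilbert_eq I I' : monomial_ideal I -> monomial_ideal I' ->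
  revlex_closed I -> revlex_closed I' -> same_hilbert_function I' I -> I' =i I.
Proof.
move=> monoI monoI' rlI rlI' hilb.
have eqX t : ('X_[t] \in I) = ('X_[t] \in I').
  have [d] := ubnP (mdeg t); elim: d t => // d IHd t; rewrite ltnS => le_td.
  have eq_lt u : (mdeg u < mdeg t)%N -> ('X_[u] \in I) = ('X_[u] \in I').
    by move=> lt_ut; apply: IHd; apply: leq_trans lt_ut le_td.
  have eq_size := same_hilbert_standard (mdeg t) monoI monoI' hilb.
  apply/idP/idP; apply: (revlex_closed_degree_sub (d := mdeg t)) => //.
  by move=> u /eq_lt.
move=> p; apply/idP/idP => pI; apply: supp_mem_ideal => t tp.
  by rewrite eqX; apply: monomial_ideal_supp tp.
by rewrite -eqX; apply: monomial_ideal_supp tp.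
Qed.

End HilbertFunction.

Theorem theorem5p8 (K : fieldType) (char0 : [pchar K]%R =i pred0)
    (I : ideal {mpoly K[3]}) (I_stable : strongly_stable I) (I_SLP : quot_SLP I) :
  almost_revlex I /\
  forall I' : ideal {mpoly K[3]},
    strongly_stable I' -> quot_SLP I' -> same_hilbert_function I' I ->
    I' =i I.
Proof.
have rlI := stable_SLP_revlex_closed I_stable I_SLP.
have [monoI _] := I_stable; split.
  by exists (min_generator I); first exact: min_generators_minimally_generate.
move=> I' stabI' slpI' hilb.
apply: revlex_closed_hilbert_eq hilb => //; first by case: stabI'.
exact: stable_SLP_revlex_closed.
Qed.
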